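(* Let $n\ge 2$, let $z_1,\dots,z_n$ be distinct complex numbers, let $a_1,\dots,a_n>0$ with $\sum_{i=1}^n a_i=1$, and let $w_1,\dots,w_{n-1}$ be complex numbers. For $1\le k\le n-1$, $\lambda\in\mathbb{C}\setminus\{0\}$ and $\mu\in\mathbb{C}$ let $$W_k^{[k]}(\lambda,\mu)=\Big(\prod_{j=1}^k(\lambda w_{r_j}+\mu)\Big)_{1\le r_1<\dots<r_k\le n-1},\qquad Z_k^{[k]}(\lambda,\mu)=\Big(\prod_{j=1}^k(\lambda z_{s_j}+\mu)\Big)_{1\le s_1<\dots<s_k\le n},$$ $$\mathbf{a}^{[k]}=\Big(\tbinom{n-1}{k}^{-1},\dots,\tbinom{n-1}{k}^{-1}\Big)\in\mathbb{R}^{\binom{n-1}{k}},\qquad \mathbf{b}^{[k]}=\Big(\tbinom{n-1}{k}^{-1}\big(1-\sum_{i=1}^k a_{s_i}\big)\Big)_{1\le s_1<\dots<s_k\le n}\in\mathbb{R}^{\binom{n}{k}},$$ where all index sets of $k$-tuples are ordered lexicographically. The following conditions are equivalent: (i) The zeros of $f(z)=\sum_{i=1}^n\frac{a_i}{z-z_i}$ counted with multiplicity are $w_1,\dots,w_{n-1}$, that is, $\sum_{i=1}^n a_i\prod_{j\ne i}(z-z_j)=\prod_{k=1}^{n-1}(z-w_k)$ for all $z\in\mathbb{C}$. (ii) There exist $\lambda\in\mathbb{C}\setminus\{0\}$ and $\mu\in\mathbb{C}$ such that $\big(W_k^{[k]}(\lambda,\mu),\mathbf{a}^{[k]}\big)\prec\big(Z_k^{[k]}(\lambda,\mu),\mathbf{b}^{[k]}\big)$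 for $1\le k\le n-1$. (iii) There exist $\lambda\in\mathbb{C}\setminus\{0\}$ and $\mu\in\mathbb{C}$ such that for every $k\in\{1,\dots,n-1\}$ there is a $\binom{n-1}{k}\times\binom{n}{k}$ row stochastic matrix $R_k(\lambda,\mu)$ with $W_k^{[k]}(\lambda,\mu)^T=R_k(\lambda,\mu)Z_k^{[k]}(\lambda,\mu)^T$ and $\mathbf{b}^{[k]}=\mathbf{a}^{[k]}R_k(\lambda,\mu)$. (iv) There exist $\lambda\in\mathbb{C}\setminus\{0\}$ and $\mu\in\mathbb{C}$ such that for every $k\in\{1,\dots,n-1\}$ the inequality $$\sum_{1\le r_1<\dots<r_k\le n-1}\Phi\Big(\prod_{j=1}^k(\lambda w_{r_j}+\mu)\Big)\le\sum_{1\le s_1<\dots<s_k\le n}\Big(1-\sum_{i=1}^k a_{s_i}\Big)\Phi\Big(\prod_{j=1}^k(\lambda z_{s_j}+\mu)\Big)$$ holds for all (continuous) convex functions $\Phi:\mathbb{C}\to\mathbb{R}$. (v) Either of conditions (ii)–(iv) is true with $\lambda=1$ and $\mu=0$. Moreover, if these conditions are fulfilled, then for every $k\in\{1,\dots,n-1\}$ there exists a $\binom{n-1}{k}\times\binom{n}{k}$ row stochastic matrix $R_k$ such that $$W_k^{[k]}(\lambda,\mu)^T=R_kZ_k^{[k]}(\lambda,\mu)^T\quad\text{and}\quad \mathbf{b}^{[k]}=\mathbf{a}^{[k]}R_k$$ for all $\lambda\in\mathbb{C}\setminus\{0\}$ and $\mu\in\mathbb{C}$.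
   Context: $\mathbb{C}$ is identified with $\mathbb{R}^2$ when speaking of convex functions. A row stochastic matrix is a matrix with nonnegative real entries all of whose row sums equal $1$. Weighted majorization: let $X=(x_1,\dots,x_m)\in\mathbb{C}^m$, $Y=(y_1,\dots,y_l)\in\mathbb{C}^l$, and let $\mathbf{p}=(p_1,\dots,p_m)$, $\mathbf{q}=(q_1,\dots,q_l)$ be vectors of positive weights each with sum $1$. One writes $(X,\mathbf{p})\prec(Y,\mathbf{q})$ if $\sum_i p_i\Phi(x_i)\le\sum_j q_j\Phi(y_j)$ for every convex $\Phi:\mathbb{C}\to\mathbb{R}$; by a theorem of Sherman this is equivalent to the existence of a row stochastic $m\times l$ matrix $R$ with $X^T=RY^T$ and $\mathbf{q}=\mathbf{p}R$. *)

(* Defs.v *)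
From mathcomp Require Import classical_sets reals interval_inference convex complex.
From mathcomp Require Import all_boot all_order all_algebra.

Set Implicit Arguments.
Unset Strict Implicit.
Unset Printing Implicit Defensive.

Import Order.TTheory GRing.Theory Num.Theory.

Local Open Scope ring_scope.
Local Open Scope complex_scope.

Definition incr_tuples (k n : nat) : {set k.-tuple 'I_n} :=
  [set t : k.-tuple 'I_n | sorted ltn (map val t)].

(* The same set over the alias [k.-tuplelexi 'I_n] of [k.-tuple 'I_n], which
   carries the lexicographic order. *)
Definition incr_tuples_lexi (k n : nat) : {set k.-tuplelexi 'I_n} :=
  incr_tuples k n.

Lemma card_incr_tuples_lexi (k n : nat) : #|incr_tuples_lexi k n| = 'C(n, k).
Proof. exact: card_ltn_sorted_tuples. Qed.

(* [Order.enum_val] enumerates in increasing order, so [lex_tuple i] is the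
   i-th strictly increasing k-tuple in lexicographic order. *)
Definition lex_tuple (k n : nat) (i : 'I_('C(n, k))) : k.-tuple 'I_n :=
  Order.enum_val (cast_ord (esym (card_incr_tuples_lexi k n)) i).

Lemma lex_tupleP (k n : nat) (i : 'I_('C(n, k))) :
  lex_tuple i \in incr_tuples k n.
Proof. exact: (Order.enum_valP (cast_ord _ i)). Qed.

Lemma lex_tuple_mono (k n : nat) (i j : 'I_('C(n, k))) :
  ((lex_tuple i : k.-tuplelexi 'I_n) <= lex_tuple j)%O = (i <= j)%N.
Proof. by rewrite /lex_tuple Order.le_enum_val//; apply: le_total. Qed.

Section Definitions.
Variable R : realType.

(* [R[i]] is not an R-module by default; [Rcomplex R] is the alias that carries
   its structure of real vector space. *)
Definition convex_on_C (Phi : R[i] -> R) : Prop :=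
  @convex_function R (Rcomplex R) [set: Rcomplex R]%classic Phi.

Lemma convex_on_CP (Phi : R[i] -> R) :
  convex_on_C Phi <->
  forall (t : R) (x y : R[i]), 0 <= t <= 1 ->
    Phi (t%:C * x + (1 - t)%:C * y) <= t * Phi x + (1 - t) * Phi y.
Proof.
have E (t : R) (x : Rcomplex R) : t *: x = t%:C * (x : R[i]) :> R[i].
  case: x => u v; rewrite /GRing.mul/= /GRing.scale/=.
  by rewrite !mul0r subr0 addr0.
split=> [h t x y t01|h t x y _ _].
  have := h (Itv01 (andP t01).1 (andP t01).2) x y.
  by rewrite -!E; apply; apply: mem_set.
have := h t%:num x y; rewrite -!E; apply.
by rewrite ge0 le1.
Qed.

(* The weights are meant to be positive with sum 1; see [equal_weightsP] and
   [compl_weightsP] for the weights used below. *)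
Definition wmajorized (m l : nat) (X : 'rV[R[i]]_m) (p : 'rV[R]_m)
    (Y : 'rV[R[i]]_l) (q : 'rV[R]_l) : Prop :=
  forall Phi : R[i] -> R, convex_on_C Phi ->
    \sum_i p 0 i * Phi (X 0 i) <= \sum_j q 0 j * Phi (Y 0 j).

Definition row_stochastic (m l : nat) (A : 'M[R]_(m, l)) : Prop :=
  (forall i j, 0 <= A i j) /\ (forall i, \sum_j A i j = 1).

Definition kprods (k m : nat) (x : 'I_m -> R[i]) (lambda mu : R[i]) :
    'rV[R[i]]_('C(m, k)) :=
  \row_i \prod_(j < k) (lambda * x (tnth (lex_tuple i) j) + mu).

Definition equal_weights (n k : nat) : 'rV[R]_('C(n.-1, k)) :=
  \row_i ('C(n.-1, k)%:R)^-1.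

Definition compl_weights (n k : nat) (a : 'I_n -> R) : 'rV[R]_('C(n, k)) :=
  \row_i (('C(n.-1, k)%:R)^-1 * (1 - \sum_(j < k) a (tnth (lex_tuple i) j))).

Section Conditions.
Variables (n : nat) (z : 'I_n -> R[i]) (a : 'I_n -> R) (w : 'I_n.-1 -> R[i]).

Definition majorization_cond (lambda mu : R[i]) : Prop :=
  forall k : nat, (1 <= k <= n.-1)%N ->
    wmajorized (kprods k w lambda mu) (equal_weights n k)
               (kprods k z lambda mu) (compl_weights k a).

Definition stochastic_relation (k : nat) (A : 'M[R]_('C(n.-1, k), 'C(n, k)))
    (lambda mu : R[i]) : Prop :=
  (kprods k w lambda mu)^T =
    map_mx (real_complex R) A *m (kprods k z lambda mu)^T
  /\ compl_weights k a = equal_weights n k *m A.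

Definition stochastic_cond (lambda mu : R[i]) : Prop :=
  forall k : nat, (1 <= k <= n.-1)%N ->
    exists A : 'M[R]_('C(n.-1, k), 'C(n, k)),
      row_stochastic A /\ stochastic_relation A lambda mu.

Definition convex_cond (lambda mu : R[i]) : Prop :=
  forall k : nat, (1 <= k <= n.-1)%N ->
    forall Phi : R[i] -> R, convex_on_C Phi ->
      \sum_(r in incr_tuples k n.-1)
          Phi (\prod_(j < k) (lambda * w (tnth r j) + mu))
      <= \sum_(s in incr_tuples k n)
          (1 - \sum_(j < k) a (tnth s j))
          * Phi (\prod_(j < k) (lambda * z (tnth s j) + mu)).

End Conditions.

End Definitions.

Lemma big_lex_tuple (V : nmodType) (k n : nat) (F : k.-tuple 'I_n -> V) :
  \sum_(i < 'C(n, k)) F (lex_tuple i) = \sum_(t in incr_tuples k n) F t.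
Proof.
have inj : injective (@lex_tuple k n).
  move=> i j e; apply: (@cast_ord_inj _ _ (esym (card_incr_tuples_lexi k n))).
  by apply/val_inj/anti_leq; rewrite -!lex_tuple_mono e lexx.
have -> : incr_tuples k n = [set lex_tuple i | i in 'I_('C(n, k))].
  apply/esym/eqP; rewrite eqEcard card_imset// card_ord.
  rewrite card_ltn_sorted_tuples leqnn andbT.
  by apply/subsetP => _ /imsetP[i _ ->]; apply: lex_tupleP.
by rewrite (big_imset (h := @lex_tuple k n) F)//= => i j _ _; apply: inj.
Qed.

Lemma incr_tuples_uniq (k n : nat) (t : k.-tuple 'I_n) :
  t \in incr_tuples k n -> uniq t.
Proof.
rewrite inE => ht; rewrite -(map_inj_uniq val_inj).
exact: (sorted_uniq ltn_trans ltnn).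
Qed.

(* The k-tuples avoiding i correspond to the k-subsets of the complement of i. *)
Lemma card_incr_tuples_notin (k n : nat) (i : 'I_n) :
  #|[set t in incr_tuples k n | i \notin t]| = 'C(n.-1, k).
Proof.
pose f (t : k.-tuple 'I_n) := [set x in t].
have finj : {in incr_tuples k n &, injective f}.
  move=> s t; rewrite !inE => hs ht /setP e.
  apply/val_inj/(inj_map val_inj) => /=.
  apply: (irr_sorted_eq ltn_trans ltnn) => // x.
  apply/mapP/mapP => -[y hy ->]; exists y => //.
    by move: (e y); rewrite !inE hy => <-.
  by move: (e y); rewrite !inE hy => ->.
have fcard t : t \in incr_tuples k n -> #|f t| = k.
  by move=> /incr_tuples_uniq/card_uniqP; rewrite cardsE size_tuple.
have fim : f @: incr_tuples k n = [set A : {set 'I_n} | #|A| == k].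
  apply/eqP; rewrite eqEcard (card_in_imset finj) card_ltn_sorted_tuples.
  rewrite card_draws card_ord leqnn andbT.
  by apply/subsetP => _ /imsetP[t /fcard tk ->]; rewrite inE tk.
rewrite -(card_in_imset (f := f)); last first.
  move=> s t; rewrite inE => /andP[hs _]; rewrite inE => /andP[ht _].
  exact: finj.
transitivity #|[set A : {set 'I_n} | (A \subset [set~ i]) && (#|A| == k)]|.
  congr #|pred_of_set _|; apply/setP => A; rewrite inE.
  apply/imsetP/andP => [[t]|[sA cA]].
    rewrite inE => /andP[ht it] ->; rewrite fcard//; split=> //.
    by apply/subsetP => x; rewrite !inE; apply: contraL => /eqP->.
  have : A \in f @: incr_tuples k n by rewrite fim inE.
  case/imsetP => t ht eA; exists t => //; rewrite inE ht/=.
  by apply/negP => it; move/subsetP: sA => /(_ i); rewrite eA !inE it eqxx => /(_ isT).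
by rewrite cards_draws cardsC1 card_ord.
Qed.

Section Weights.
Variable R : realType.

Lemma equal_weightsP (n k : nat) : (1 <= k <= n.-1)%N ->
  (forall i, 0 < equal_weights R n k 0 i) /\
  \sum_i equal_weights R n k 0 i = 1.
Proof.
move=> /andP[_ kn].
have C0 : 0 < ('C(n.-1, k)%:R : R) by rewrite ltr0n bin_gt0.
split=> [i|]; first by rewrite mxE invr_gt0.
under eq_bigr do rewrite mxE.
by rewrite sumr_const card_ord -[LHS]mulr_natr mulVf ?gt_eqF.
Qed.

Lemma compl_weightsP (n k : nat) (a : 'I_n -> R) : (1 <= k <= n.-1)%N ->
  (forall i, 0 < a i) -> \sum_i a i = 1 ->
  (forall i, 0 < compl_weights k a 0 i) /\
  \sum_i compl_weights k a 0 i = 1.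
Proof.
move=> /andP[k1 kn] a0 a1.
have C0 : 0 < ('C(n.-1, k)%:R : R) by rewrite ltr0n bin_gt0.
have n1 : (1 < n)%N by rewrite -ltn_predRL (leq_trans k1).
have ltkn : (k < n)%N by rewrite -(prednK (ltnW n1)) ltnS.
have E (t : k.-tuple 'I_n) : t \in incr_tuples k n ->
    1 - \sum_(j < k) a (tnth t j) = \sum_(i | i \notin t) a i.
  move=> /incr_tuples_uniq ut; apply/eqP; rewrite subr_eq -a1.
  rewrite (bigID (mem t))/= addrC -(big_uniq _ ut) big_tuple.
  exact: eqxx.
split=> [i|].
  rewrite mxE mulr_gt0 ?invr_gt0// E ?lex_tupleP//.
  have : (0 < #|[predC lex_tuple i]|)%N.
    have := cardC (mem (lex_tuple i)).
    rewrite card_ord (card_uniqP (incr_tuples_uniq (lex_tupleP i))) size_tuple.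
    by move=> e; rewrite -(ltn_add2l k) addn0 e.
  case/card_gt0P => j; rewrite inE => jt.
  rewrite (bigD1 j)//= ltr_wpDr//.
  by apply: sumr_ge0 => x _; apply: ltW.
under eq_bigr do rewrite mxE.
rewrite -mulr_sumr (big_lex_tuple (fun t => 1 - \sum_(j < k) a (tnth t j))).
rewrite (eq_bigr (fun t : k.-tuple 'I_n => \sum_(i | i \notin t) a i))//.
rewrite (exchange_big_dep xpredT)//=.
rewrite (eq_bigr (fun i => 'C(n.-1, k)%:R * a i)) => [|i _].
  by rewrite -mulr_sumr a1 mulr1 mulVf ?gt_eqF.
rewrite sumr_const -(card_incr_tuples_notin k i) -[LHS]mulr_natl.
congr (GRing.natmul _ _ * _); apply: eq_card => t.
by rewrite [in RHS]inE.
Qed.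

End Weights.

(* Main.v *)
(* Let v be the unit vector with entries sqrt (a i).  By Cauchy-Binet, the
   compression of diag(z) to the orthogonal complement of v has characteristic
   polynomial \sum_i a_i \prod_(j != i) (x - z_j).  If its zeros are the w_k,
   Schur's theorem provides an orthonormal basis U of that complement in which
   the compression is triangular with diagonal w.  Taking k x k principal minors
   of U (lambda diag(z) + mu) U^* by Cauchy-Binet expresses the products of the
   lambda w_r + mu through those of the lambda z_s + mu with coefficients
   |det U[r,s]|^2, which do not depend on lambda and mu and form the required
   row stochastic matrix.  Conversely, testing the convex inequalities on the
   linear functions Re, -Re, Im and -Im gives equalities which say that the two
   sides of (i), taken in the variable lambda x + mu, have the same
   coefficients. *)

Require Import Defs.
From mathcomp Require Import all_boot all_order all_fingroup all_algebra.
From mathcomp Require Import reals complex.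
From mathcomp Require Import ring lra.

Set Implicit Arguments.
Unset Strict Implicit.
Unset Printing Implicit Defensive.

Import Order.TTheory GRing.Theory Num.Theory.

Local Open Scope ring_scope.
Local Open Scope complex_scope.
Local Open Scope sesquilinear_scope.

(** * Increasing tuples, the Cauchy-Binet formula and determinants of special matrices *)

Lemma incr_tuples_inj k n (t : k.-tuple 'I_n) :
  t \in incr_tuples k n -> injective (tnth t).
Proof. by move=> /incr_tuples_uniq/tuple_uniqP. Qed.

Lemma eq_incr_tuples k n (s t : k.-tuple 'I_n) :
  s \in incr_tuples k n -> t \in incr_tuples k n -> s =i t -> s = t.
Proof.
rewrite !inE => hs ht st; apply/val_inj/(inj_map val_inj) => /=.
by apply: (irr_sorted_eq ltn_trans ltnn) => // x; apply: eq_mem_map.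
Qed.

Lemma sort_incr_tuples k n (t : k.-tuple 'I_n) :
  uniq t -> sort_tuple (fun i j : 'I_n => (i <= j)%N) t \in incr_tuples k n.
Proof.
move=> ut; rewrite inE /= ltn_sorted_uniq_leq (map_inj_uniq val_inj) sort_uniq ut.
by rewrite sorted_map; apply: sort_sorted => i j; apply: leq_total.
Qed.

(** Sorting the values of an injective map factors it uniquely as an increasing tuple composed with
    a permutation. *)
Lemma big_injective_ffun (V : nmodType) k n (G : {ffun 'I_k -> 'I_n} -> V) :
  \sum_(f : {ffun 'I_k -> 'I_n} | injectiveb f) G f =
  \sum_(t in incr_tuples k n) \sum_(s : 'S_k) G [ffun i => tnth t (s i)].
Proof.
pose h (p : k.-tuple 'I_n * 'S_k) := [ffun i => tnth p.1 (p.2 i)].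
rewrite pair_big_dep /=.
rewrite [LHS](eq_bigl (mem (h @: [set p | p.1 \in incr_tuples k n]))); last first.
  move=> f; apply/injectiveP/imsetP => [fi|[[t s] /= ht ->] i j].
    have ut : uniq [tuple f i | i < k].
      by apply/tuple_uniqP => i j; rewrite !tnth_mktuple => /fi.
    have /tuple_permP[s es] : perm_eq [tuple f i | i < k]
        (sort_tuple (fun i j : 'I_n => (i <= j)%N) [tuple f i | i < k]).
      by rewrite perm_sym perm_sort.
    exists (sort_tuple (fun i j : 'I_n => (i <= j)%N) [tuple f i | i < k], s).
      by rewrite in_set; apply: sort_incr_tuples.
    apply/ffunP => i; rewrite ffunE /=.
    have /(congr1 (fun u : k.-tuple 'I_n => tnth u i)) := val_inj es.
    by rewrite !tnth_mktuple.
  rewrite !ffunE /=; rewrite inE /= in ht.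
  by move/(incr_tuples_inj ht)/perm_inj.
rewrite big_imset /=; first by apply: eq_big => [[t s]|//]; rewrite in_set andbT.
move=> [t s] [t' s']; rewrite !(in_set (fun p : _ * _ => p.1 \in _)) /=.
move=> ht ht' /ffunP e.
have et : t = t'.
  apply: eq_incr_tuples => // x; apply/tnthP/tnthP => -[i ->].
    by exists (s' (s^-1 i)%g); have := e (s^-1 i)%g; rewrite !ffunE /= permKV.
  by exists (s (s'^-1 i)%g); have := e (s'^-1 i)%g; rewrite !ffunE /= permKV.
congr pair => //; apply/permP => i.
by have := e i; rewrite !ffunE /= -et => /(incr_tuples_inj ht).
Qed.

(** Expanding only along [A] leaves a sum over all maps [f] of minors of [B] with rows [f]. A
    non-injective [f] repeats a row and contributes zero; an injective one is an increasing tuple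
    times a permutation, whose sign rebuilds the minor of [A]. *)
Lemma Cauchy_Binet (R : comNzRingType) k n (A : 'M[R]_(k, n)) (B : 'M[R]_(n, k)) :
  \det (A *m B) =
  \sum_(t in incr_tuples k n) \det (colsub (tnth t) A) * \det (rowsub (tnth t) B).
Proof.
transitivity (\sum_(f : {ffun 'I_k -> 'I_n}) \det (rowsub f B) * \prod_i A i (f i)).
  rewrite /determinant.
  transitivity (\sum_(s : 'S_k) \sum_(f : {ffun 'I_k -> 'I_n})
      (-1) ^+ s * \prod_i (A i (f i) * B (f i) (s i))).
    apply: eq_bigr => s _; rewrite -big_distrr /=; congr (_ * _).
    rewrite -(bigA_distr_bigA (fun i j => A i j * B j (s i))) /=.
    by apply: eq_bigr => i _; rewrite mxE.
  rewrite exchange_big; apply: eq_bigr => f _; rewrite big_distrl /=.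
  apply: eq_bigr => s _; rewrite big_split /= mulrA mulrAC; congr (_ * _ * _).
  by apply: eq_bigr => i _; rewrite mxE.
rewrite (bigID (fun f : {ffun _} => injectiveb f)) /= addrC big1 ?add0r => [|f].
  rewrite big_injective_ffun; apply: eq_bigr => t _.
  rewrite [RHS]big_distrl /=; apply: eq_bigr => s _.
  have -> : rowsub [ffun i => tnth t (s i)] B = row_perm s (rowsub (tnth t) B).
    by apply/matrixP => i j; rewrite !mxE ffunE.
  rewrite row_permE det_mulmx det_perm mulrAC; congr (_ * _ * _).
  by apply: eq_bigr => i _; rewrite mxE ffunE.
case/injectivePn => i [j ij fij].
by rewrite (determinant_alternate ij) ?mul0r// => l; rewrite !mxE fij.
Qed.

(** The block matrix with identity diagonal blocks and off-diagonal blocks [c] and [r] is factored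
    as lower times upper and as upper times lower triangular; comparing determinants gives the
    formula. *)
Lemma det_1BM (R : comNzRingType) k (c : 'cV[R]_k) (r : 'rV[R]_k) :
  \det (1%:M - c *m r) = 1 - (r *m c) 0 0.
Proof.
have E : block_mx 1%:M 0 r 1%:M *m block_mx 1%:M c 0 (1%:M - r *m c) =
         block_mx (1%:M - c *m r) c 0 1%:M *m block_mx 1%:M 0 r (1%:M : 'M_1).
  rewrite !mulmx_block !mul1mx !mulmx1 !mul0mx !mulmx0 !addr0 !add0r.
  by congr block_mx; [rewrite subrK | rewrite addrC subrK].
move/(congr1 (@determinant _ _)): E.
rewrite !det_mulmx !det_lblock !det_ublock !det1 !mul1r !mulr1 => <-.
by rewrite det_mx11 !mxE.
Qed.

(** Since [f] need not be increasing, the submatrix need not be triangular; still, only the identity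
    permutation survives in the Leibniz expansion. *)
Lemma det_mxsub_trig (R : comNzRingType) k n (T : 'M[R]_n) (f : 'I_k -> 'I_n) :
  is_trig_mx T -> injective f -> \det (mxsub f f T) = \prod_i T (f i) (f i).
Proof.
move=> /is_trig_mxP trT fi; rewrite /determinant (bigD1 1%g) //= odd_perm1 mul1r.
rewrite [X in _ + X]big1 ?addr0 => [|s s1].
  by apply: eq_bigr => i _; rewrite mxE perm1.
have [/existsP[i fs]|] := boolP [exists i, (f i < f (s i))%N].
  by rewrite (bigD1 i) //= mxE trT // mul0r mulr0.
(* If f (s i) <= f i for all i, summing over i gives equality everywhere. *)
rewrite negb_exists => /forallP ge; case/eqP: s1; apply/permP => i; rewrite perm1.
have /leqif_sum[_] i0 : true ->
    (f (s i0) <= f i0 ?= iff (f (s i0) == f i0 :> nat))%N.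
  by move=> _; split=> //; rewrite leqNgt.
rewrite [X in _ == X](reindex_perm s) eqxx => /esym/forallP/(_ i)/eqP e.
exact/fi/val_inj.
Qed.

(** * Expansion of products of sums over increasing tuples *)

Lemma sum_incr_tuples (V : nmodType) (k n : nat) (F : {set 'I_n} -> V) :
  \sum_(J : {set 'I_n} | #|J| == k) F J =
  \sum_(t in incr_tuples k n) F [set i in t].
Proof.
pose f (t : k.-tuple 'I_n) := [set i in t].
have finj : {in incr_tuples k n &, injective f}.
  move=> s t hs ht /setP e; apply: eq_incr_tuples => // x.
  by have := e x; rewrite !in_set.
rewrite -(big_imset F finj); apply: eq_bigl => J.
have -> : f @: incr_tuples k n = [set A : {set 'I_n} | #|A| == k]; last by rewrite in_set.
apply/eqP; rewrite eqEcard (card_in_imset finj) card_ltn_sorted_tuples.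
rewrite card_draws card_ord leqnn andbT; apply/subsetP => _ /imsetP[t ht ->].
by rewrite in_set cardsE (card_uniqP (incr_tuples_uniq ht)) size_tuple.
Qed.

Lemma prod_set_tuple (R : comNzRingType) k n (t : k.-tuple 'I_n) (y : 'I_n -> R) :
  t \in incr_tuples k n ->
  \prod_(i in [set i in t]) y i = \prod_j y (tnth t j).
Proof.
move=> /incr_tuples_uniq ut; rewrite -(big_tuple _ _ t xpredT y) big_uniq //=.
by apply: eq_bigl => i; rewrite in_set.
Qed.

Lemma sum_set_tuple (V : nmodType) k n (t : k.-tuple 'I_n) (y : 'I_n -> V) :
  t \in incr_tuples k n ->
  \sum_(i in [set i in t]) y i = \sum_j y (tnth t j).
Proof.
move=> /incr_tuples_uniq ut; rewrite -(big_tuple _ _ t xpredT y) big_uniq //=.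
by apply: eq_bigl => i; rewrite in_set.
Qed.

(** Vieta's formula: the coefficients are the elementary symmetric functions of [y], obtained by
    grouping the subsets of the index set by cardinality. *)
Lemma prod_addl_incr_tuples (R : comNzRingType) m (y : 'I_m -> R) x :
  \prod_i (x + y i) = \sum_(k < m.+1) x ^+ (m - k) *
    \sum_(t in incr_tuples k m) \prod_j y (tnth t j).
Proof.
under eq_bigr do rewrite addrC.
rewrite bigA_distr.
rewrite (partition_big (fun J : {set _} => inord #|J|) (xpredT : pred 'I_m.+1)) //=.
apply: eq_bigr => k _; rewrite big_distrr /=.
rewrite [RHS](eq_bigr (fun t : k.-tuple 'I_m =>
    x ^+ (m - k) * \prod_(i in [set i in t]) y i));
  last by move=> t ht; rewrite prod_set_tuple.
rewrite -(sum_incr_tuples k (fun J => x ^+ (m - k) * \prod_(i in J) y i)).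
have eqk (J : {set 'I_m}) : (inord #|J| == k) = (#|J| == k).
  by rewrite -val_eqE /= inordK // ltnS -[m in (_ <= m)%N]card_ord max_card.
apply: eq_big => [J|J]; rewrite eqk // => /eqP <-.
rewrite (bigID (mem J)) /= mulrC; congr (_ * _).
  rewrite (eq_bigr (fun=> x)) => [|i /negPf -> //].
  rewrite prodr_const; congr (_ ^+ _).
  by have /(congr1 (subn^~ #|J|)) := cardC (mem J); rewrite addKn card_ord.
by apply: eq_bigr => i ->.
Qed.

(** After expansion, the monomial of a subset [J] collects the weights [a i] of all [i] outside [J];
    as the total weight is 1, this is the factor that defines [compl_weights]. *)
Lemma weighted_prod_addl_incr_tuples (R : comNzRingType) m (a y : 'I_m.+1 -> R) x :
  \sum_i a i = 1 ->
  \sum_i a i * \prod_(j | j != i) (x + y j) =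
  \sum_(k < m.+1) x ^+ (m - k) *
    \sum_(t in incr_tuples k m.+1) (1 - \sum_j a (tnth t j)) * \prod_j y (tnth t j).
Proof.
move=> a1.
pose F (J : {set 'I_m.+1}) :=
  (1 - \sum_(i in J) a i) * (x ^+ (m - #|J|) * \prod_(j in J) y j).
transitivity (\sum_J F J).
  transitivity (\sum_i \sum_(J : {set 'I_m.+1} | i \notin J)
      a i * (x ^+ (m - #|J|) * \prod_(j in J) y j)).
    apply: eq_bigr => i _; rewrite -big_distrr /=; congr (_ * _).
    (* A factor [0 + 1] is inserted at [i], so that the product runs over all indices and every
       subset containing [i] contributes zero to its expansion. *)
    transitivity (\prod_j ((if j == i then 0 else y j) + (if j == i then 1 else x))).
      rewrite [RHS](bigD1 i) //= eqxx add0r mul1r.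
      by apply: eq_bigr => j /negPf ->; rewrite addrC.
    rewrite bigA_distr [LHS](bigID (fun J : {set _} => i \in J)) /=.
    rewrite big1 ?add0r => [|J iJ].
      apply: eq_bigr => J iJ; rewrite [LHS](bigID (mem J)) /= mulrC; congr (_ * _).
        rewrite (bigD1 i) //= (negPf iJ) eqxx mul1r.
        rewrite (eq_bigr (fun=> x)) => [|j /andP[/negPf -> /negPf -> //]].
        rewrite prodr_const; congr (_ ^+ _).
        have := cardC (mem J); rewrite card_ord (cardD1 i [predC J]) inE /= iJ.
        rewrite addnCA add1n.
        move=> -[/(congr1 (subn^~ #|J|))]; rewrite addKn => <-.
        by apply: eq_card => j; rewrite !inE andbC.
      apply: eq_bigr => j jJ; rewrite jJ; case: eqP => // ji.
      by rewrite -ji jJ in iJ.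
    by rewrite (bigD1 i) //= iJ eqxx mul0r.
  rewrite (exchange_big_dep xpredT) //=; apply: eq_bigr => J _.
  rewrite -big_distrl; congr (_ * _).
  by rewrite -a1 [in RHS](bigID (mem J)) /= addrAC subrr add0r.
rewrite (partition_big (fun J : {set _} => inord #|J|) (xpredT : pred 'I_m.+2)) //=.
have eqk (k : 'I_m.+2) (J : {set 'I_m.+1}) : (inord #|J| == k) = (#|J| == k).
  by rewrite -val_eqE /= inordK // ltnS -[X in (_ <= X)%N]card_ord max_card.
(* The top cardinality [m.+1] occurs only for the full set, whose complementary weight is zero;
   hence the sum stops at [m]. *)
rewrite big_ord_recr /= [X in _ + X]big1 ?addr0 => [|J]; last first.
  rewrite eqk /= => /eqP cJ; have -> : J = setT.
    by apply/eqP; rewrite eqEcard subsetT cardsT card_ord cJ leqnn.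
  by rewrite /F (eq_bigl xpredT a) ?a1 ?subrr ?mul0r // => i; rewrite inE.
apply: eq_bigr => k _; rewrite big_distrr /=.
rewrite (eq_bigl (fun J : {set _} => #|J| == k)); last by move=> J; rewrite eqk.
rewrite sum_incr_tuples; apply: eq_bigr => t ht.
rewrite /F sum_set_tuple // prod_set_tuple // cardsE.
by rewrite (card_uniqP (incr_tuples_uniq ht)) size_tuple mulrCA.
Qed.

(** * Compression of a diagonal matrix to the orthogonal complement of a unit vector *)

Lemma det_trmxC (C : numClosedFieldType) n (A : 'M[C]_n) :
  \det (A ^t*) = (\det A)^*%R.
Proof. by rewrite det_map_mx det_tr. Qed.

(** Gram-Schmidt on the kernel of [v ^t*] gives the rows of [U]. Stacked below [v] they form a
    square unitary matrix, and its left inverse relation is the required identity. *)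
Lemma orthonormal_complement (C : numClosedFieldType) m (v : 'rV[C]_m.+1) :
  v \is unitarymx ->
  exists2 U : 'M[C]_(m, m.+1),
    U \is unitarymx & U ^t* *m U = 1%:M - v ^t* *m v.
Proof.
move=> v1.
pose B := row_base (kermx (v ^t*)); pose W := schmidt B.
have W1 : W \is unitarymx by apply: schmidt_unitarymx; apply: rank_leq_col.
have Wv : W *m v ^t* = 0.
  apply/sub_kermxP.
  by rewrite eqmx_schmidt_free ?row_base_free // eq_row_base.
have : \rank (kermx (v ^t*)) = m.
  by rewrite mxrank_ker mxrank_map mxrank_tr mxrank_unitary // subSS subn0.
(* The rank of the kernel occurs in the type of [W], so it is generalized before being replaced by
   [m]. *)
move: W W1 Wv; rewrite /B; move: (\rank _) => r W W1 Wv rm; move: W W1 Wv.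
rewrite {r}rm => W W1 Wv; exists W => //.
have vW : v *m W ^t* = 0.
  by rewrite -[LHS]trmxCK trmx_mul map_mxM trmxCK Wv trmx0 map_mx0.
have /unitarymxP/mulmx1C : (col_mx v W : 'M_(1 + m)) \is unitarymx.
  apply/unitarymxP; rewrite tr_col_mx map_row_mx mul_col_row vW Wv.
  by rewrite !(unitarymxP _) // -scalar_mx_block.
by rewrite tr_col_mx map_row_mx mul_row_col => <-; rewrite addrC addKr.
Qed.

(** The two minors in Cauchy-Binet are conjugate up to the diagonal factor, so the coefficients are
    squared moduli that do not depend on [y]. *)
Lemma det_mul_diag_trmxC (C : numClosedFieldType) k n (A : 'M[C]_(k, n)) (y : 'I_n -> C) :
  \det (A *m diag_mx (\row_i y i) *m A ^t*) =
  \sum_(t in incr_tuples k n) `|\det (colsub (tnth t) A)| ^+ 2 * \prod_j y (tnth t j).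
Proof.
rewrite Cauchy_Binet; apply: eq_bigr => t _.
have -> : colsub (tnth t) (A *m diag_mx (\row_i y i)) =
    colsub (tnth t) A *m diag_mx (\row_j y (tnth t j)).
  by apply/matrixP => i j; rewrite !mul_mx_diag !mxE.
have -> : rowsub (tnth t) (A ^t*) = (colsub (tnth t) A) ^t*.
  by apply/matrixP => i j; rewrite !mxE.
rewrite det_mulmx det_diag det_trmxC normCK mulrAC.
by congr (_ * _); apply: eq_bigr => j _; rewrite mxE.
Qed.

(** On the rows and columns selected by [s], the Gram matrix is the identity minus a rank-one
    matrix, so [det_1BM] applies. *)
Lemma sqr_norm_minor_complement (C : numClosedFieldType) m n (U : 'M[C]_(m, n))
    (v : 'rV[C]_n) k (s : 'I_k -> 'I_n) :
  U ^t* *m U = 1%:M - v ^t* *m v -> injective s ->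
  \det ((colsub s U) ^t* *m colsub s U) = 1 - \sum_j `|v 0 (s j)| ^+ 2.
Proof.
move=> Uv si; have -> : (colsub s U) ^t* *m colsub s U =
    1%:M - (colsub s v) ^t* *m colsub s v.
  transitivity (mxsub s s (U ^t* *m U)).
    by rewrite mxsub_mul; congr (_ *m _); apply/matrixP => i j; rewrite !mxE.
  rewrite Uv; apply/matrixP => i j; rewrite !mxE !big_ord1 !mxE.
  by rewrite (inj_eq si).
rewrite det_1BM mxE; congr (_ - _); apply: eq_bigr => j _.
by rewrite !mxE normCK.
Qed.

(** Applied to [y i = x - z i], this identifies the characteristic polynomial of the compression
    with the numerator of [f]. *)
Lemma det_compression (C : numClosedFieldType) m (U : 'M[C]_(m, m.+1))
    (v : 'rV[C]_m.+1) (y : 'I_m.+1 -> C) :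
  v \is unitarymx -> U ^t* *m U = 1%:M - v ^t* *m v ->
  \det (U *m diag_mx (\row_i y i) *m U ^t*) =
  \sum_i `|v 0 i| ^+ 2 * \prod_(j | j != i) y j.
Proof.
move=> v1 Uv.
have a1 : \sum_i `|v 0 i| ^+ 2 = 1.
  transitivity ((v *m v ^t*) 0 0); last by rewrite (elimT unitarymxP v1) mxE.
  by rewrite mxE; apply: eq_bigr => i _; rewrite !mxE normCK.
(* Only the k = m term survives at x = 0. *)
have := weighted_prod_addl_incr_tuples y 0 a1.
under eq_bigr do under eq_bigr do rewrite add0r.
move=> ->; rewrite big_ord_recr /= subnn mul1r big1 ?add0r => [|i _]; last first.
  by rewrite expr0n subn_eq0 leqNgt ltn_ord mul0r.
rewrite det_mul_diag_trmxC; apply: eq_bigr => t ht; congr (_ * _).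
rewrite -(sqr_norm_minor_complement Uv (incr_tuples_inj ht)).
by rewrite det_mulmx det_trmxC mulrC normCK.
Qed.

(** A nonzero polynomial over a closed field has a non-root, so the two products agree as
    polynomials, and unique factorization matches their roots. *)
Lemma prod_subr_perm (C : numClosedFieldType) m (x y : 'I_m -> C) :
  (forall u, \prod_i (u - x i) = \prod_i (u - y i)) ->
  exists s : 'S_m, forall i, x i = y (s i).
Proof.
move=> e.
have /prod_XsubC_eq/tuple_permP[s es] :
    \prod_(u <- [tuple x i | i < m]) ('X - u%:P) =
    \prod_(u <- [tuple y i | i < m]) ('X - u%:P).
  apply/eqP; rewrite -subr_eq0; apply/negPn/negP => /closed_nonrootP[u].
  rewrite /root hornerD hornerN !horner_prod !big_tuple subr_eq0.
  under eq_bigr do rewrite tnth_mktuple hornerXsubC.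
  under [X in _ != X]eq_bigr do rewrite tnth_mktuple hornerXsubC.
  by rewrite e eqxx.
exists s => i; have /(congr1 (fun u : m.-tuple C => tnth u i)) := val_inj es.
by rewrite !tnth_mktuple.
Qed.

(** A single [U] serves all [lambda] and [mu], because compressing [lambda z + mu] gives
    [lambda T + mu] for the Schur form [T]. Its diagonal agrees with [w] only up to order; the rows
    of the basis are permuted accordingly, and [det_mxsub_trig] handles the resulting minors. *)
Lemma triangular_compression (C : numClosedFieldType) m (v : 'rV[C]_m.+1)
    (z : 'I_m.+1 -> C) (w : 'I_m -> C) :
  (0 < m)%N -> v \is unitarymx ->
  (forall x, \sum_i `|v 0 i| ^+ 2 * \prod_(j | j != i) (x - z j) = \prod_k (x - w k)) ->
  exists U : 'M[C]_(m, m.+1),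
    [/\ U \is unitarymx, U ^t* *m U = 1%:M - v ^t* *m v &
      forall k (f : 'I_k -> 'I_m) lambda mu, injective f ->
        \det (rowsub f U *m diag_mx (\row_i (lambda * z i + mu)) *m (rowsub f U) ^t*) =
        \prod_j (lambda * w (f j) + mu)].
Proof.
move=> m0 v1 zw; have [U0 U0_unitary U0v] := orthonormal_complement v1.
pose D lambda mu := diag_mx (\row_i (lambda * z i + mu)).
have [P P1] := Schur (U0 *m D 1 0 *m U0 ^t*) m0.
rewrite /similar_to /= conjymx //; move TE: (P *m _ *m _) => T trT.
pose V := P *m U0.
have V1 : V \is unitarymx by apply: mul_unitarymx.
have Vv : V ^t* *m V = 1%:M - v ^t* *m v.
  rewrite trmx_mul map_mxM mulmxA -[_ *m _ *m P]mulmxA.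
  by rewrite (mulmx1C (elimT unitarymxP P1)) mulmx1.
have VD lambda mu : V *m D lambda mu *m V ^t* = lambda *: T + mu%:M.
  have -> : D lambda mu = lambda *: D 1 0 + mu%:M.
    apply/matrixP => i j; rewrite !mxE.
    by case: (i == j); rewrite ?mulr1n ?mul1r ?addr0 ?mulr0n ?mulr0 ?addr0.
  rewrite mulmxDr mulmxDl -scalemxAr -scalemxAl; congr (_ *: _ + _).
    by rewrite /V trmx_mul map_mxM -TE !mulmxA.
  by rewrite mul_mx_scalar -scalemxAl (elimT unitarymxP V1) scalemx1.
have trVD lambda mu : is_trig_mx (lambda *: T + mu%:M).
  apply/is_trig_mxP => i j ij; rewrite !mxE (elimT is_trig_mxP trT) // mulr0 add0r.
  by case: eqP => // ij'; rewrite ij' ltnn in ij.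
(* The case [lambda = -1], [mu = x] of [VD] turns [det_compression] into an evaluation of the
   characteristic polynomial of [T], which by hypothesis has the zeros [w]. *)
have [s ws] : exists s : 'S_m, forall i, w i = T (s i) (s i).
  apply: (@prod_subr_perm _ _ w (fun i => T i i)) => x.
  rewrite -zw -(det_compression (fun i => x - z i) v1 Vv).
  have -> : \row_i (x - z i) = \row_i (-1 * z i + x).
    by apply/rowP => i; rewrite !mxE mulN1r addrC.
  rewrite VD det_trig //; apply: eq_bigr => i _.
  by rewrite !mxE eqxx mulr1n mulN1r addrC.
exists (row_perm s V); split.
- apply/unitarymxP; rewrite row_permE trmx_mul map_mxM tr_perm_mx map_perm_mx.
  rewrite mulmxA -[_ *m V *m _]mulmxA (elimT unitarymxP V1) mulmx1 -perm_mxM.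
  by rewrite mulgV perm_mx1.
- rewrite row_permE trmx_mul map_mxM tr_perm_mx map_perm_mx.
  by rewrite mulmxA -[_ *m _ *m perm_mx s]mulmxA -perm_mxM mulVg perm_mx1 mulmx1.
move=> k f lambda mu fi; pose g j := s (f j).
have gi : injective g by move=> i j /perm_inj/fi.
transitivity (\det (mxsub g g (V *m D lambda mu *m V ^t*))).
  rewrite mxsub_mul (mxsub_mul g id V); congr (\det (_ *m _ *m _)).
  - by apply/matrixP => i j; rewrite !mxE.
  - by rewrite mxsub_id.
  - by apply/matrixP => i j; rewrite !mxE.
rewrite VD det_mxsub_trig //; apply: eq_bigr => j _.
by rewrite !mxE eqxx mulr1n ws.
Qed.

(** * Jensen's inequality and the implications between the stochastic, majorization and convex
    conditions *)

(* Jensen's inequality; unnormalized weights make the induction go through. *)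
Lemma convex_on_C_sum (R : realType) (Phi : R[i] -> R) (I : Type) (s : seq I)
    (p : I -> R) (y : I -> R[i]) :
  convex_on_C Phi -> (forall i, 0 <= p i) -> 0 < \sum_(i <- s) p i ->
  (\sum_(i <- s) p i) * Phi ((\sum_(i <- s) p i)^-1%:C * \sum_(i <- s) (p i)%:C * y i) <=
  \sum_(i <- s) p i * Phi (y i).
Proof.
move=> /convex_on_CP cvx p0; elim: s => [|i s IHs]; first by rewrite big_nil ltxx.
rewrite !big_cons; set c := \sum_(j <- s) p j in IHs *.
set Y := \sum_(j <- s) (p j)%:C * y j in IHs *.
have c0 : 0 <= c by apply: sumr_ge0.
(* The induction hypothesis needs a positive total weight. If the tail has weight zero, all its
   terms vanish and both sides reduce to the head. *)
have [cE|cN0] := eqVneq c 0.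
  rewrite /c in cE; have E (f : I -> R) : \sum_(j <- s) p j * f j = 0.
    elim: (s) (cE) => [|j r IHr]; rewrite ?big_nil // !big_cons => /eqP.
    rewrite paddr_eq0 ?sumr_ge0 // => /andP[/eqP-> /eqP/IHr->].
    by rewrite mul0r addr0.
  have -> : Y = 0.
    rewrite /Y; elim: (s) (cE) => [|j r IHr]; rewrite ?big_nil // !big_cons => /eqP.
    rewrite paddr_eq0 ?sumr_ge0 // => /andP[/eqP-> /eqP/IHr->].
    by rewrite rmorph0 mul0r addr0.
  rewrite E /c cE !addr0 => pi0; rewrite mulrA -rmorphM mulVf ?gt_eqF //.
  by rewrite rmorph1 mul1r.
have {}c0 : 0 < c by rewrite lt_neqAle eq_sym cN0.
move=> pc0; apply: le_trans (lerD (lexx _) (IHs c0)).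
set d := p i + c in pc0 *.
have t01 : 0 <= p i / d <= 1.
  by rewrite divr_ge0 ?(ltW pc0) //= ler_pdivrMr // mul1r lerDl ltW.
(* The barycenter of the whole list is a convex combination of the head and the barycenter of the
   tail. *)
have := cvx (p i / d) (y i) (c^-1%:C * Y) t01.
have t1 : 1 - p i / d = c / d.
  by rewrite -(mulfV (lt0r_neq0 pc0)) -mulrBl addrC addKr.
rewrite t1 mulrA -rmorphM /= mulrAC mulfV // mul1r.
have -> : (p i / d)%:C * y i + d^-1%:C * Y = d^-1%:C * ((p i)%:C * y i + Y).
  by rewrite rmorphM /= mulrDr mulrA [_ * d^-1%:C]mulrC.
rewrite -(ler_pM2l pc0) => /le_trans; apply.
by rewrite mulrDr !mulrA ![d * _]mulrC !mulfK ?lt0r_neq0.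
Qed.

(** The easy half of Sherman's theorem: Jensen's inequality in each row of [A], then averaging with
    the weights [p]. *)
Lemma row_stochastic_majorization (R : realType) m l (X : 'rV[R[i]]_m) (p : 'rV[R]_m)
    (Y : 'rV[R[i]]_l) (q : 'rV[R]_l) (A : 'M[R]_(m, l)) :
  row_stochastic A -> (forall i, 0 <= p 0 i) ->
  X^T = map_mx (real_complex R) A *m Y^T -> q = p *m A -> wmajorized X p Y q.
Proof.
move=> [A0 A1] p0 XE -> Phi cvx.
have -> : \sum_j (p *m A) 0 j * Phi (Y 0 j) =
    \sum_i p 0 i * \sum_j A i j * Phi (Y 0 j).
  under [RHS]eq_bigr do rewrite mulr_sumr.
  rewrite exchange_big; apply: eq_bigr => j _.
  by rewrite mxE mulr_suml; apply: eq_bigr => i _; rewrite mulrA.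
apply: ler_sum => i _; apply: ler_wpM2l => //.
have -> : X 0 i = \sum_j (A i j)%:C * Y 0 j.
  have := congr1 (fun M : 'cV_m => M i 0) XE; rewrite !mxE => ->.
  by apply: eq_bigr => j _; rewrite !mxE.
have := @convex_on_C_sum _ _ _ (index_enum 'I_l) (A i) (Y 0) cvx (A0 i).
by rewrite A1 invr1 rmorph1 !mul1r; apply.
Qed.

Lemma majorization_convex_cond (R : realType) n (z : 'I_n -> R[i]) (a : 'I_n -> R)
    (w : 'I_n.-1 -> R[i]) lambda mu :
  majorization_cond z a w lambda mu <-> convex_cond z a w lambda mu.
Proof.
have H k (Phi : R[i] -> R) : (1 <= k <= n.-1)%N ->
    (\sum_i equal_weights R n k 0 i * Phi (kprods k w lambda mu 0 i) <=
     \sum_j compl_weights k a 0 j * Phi (kprods k z lambda mu 0 j)) =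
    (\sum_(r in incr_tuples k n.-1) Phi (\prod_(j < k) (lambda * w (tnth r j) + mu))
      <= \sum_(s in incr_tuples k n) (1 - \sum_(j < k) a (tnth s j))
          * Phi (\prod_(j < k) (lambda * z (tnth s j) + mu))).
  move=> /andP[_ kn].
  have C0 : 0 < ('C(n.-1, k)%:R : R) by rewrite ltr0n bin_gt0.
  under eq_bigr do rewrite !mxE.
  under [X in _ <= X]eq_bigr do rewrite !mxE -mulrA.
  rewrite -!mulr_sumr ler_pM2l ?invr_gt0 //.
  rewrite (big_lex_tuple (fun t => Phi (\prod_(j < k) (lambda * w (tnth t j) + mu)))).
  by rewrite (big_lex_tuple (fun t => (1 - \sum_(j < k) a (tnth t j)) *
    Phi (\prod_(j < k) (lambda * z (tnth t j) + mu)))).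
by split=> h k hk Phi cvx; have := h k hk Phi cvx; rewrite H.
Qed.

Lemma stochastic_majorization_cond (R : realType) n (z : 'I_n -> R[i]) (a : 'I_n -> R)
    (w : 'I_n.-1 -> R[i]) lambda mu :
  stochastic_cond z a w lambda mu -> majorization_cond z a w lambda mu.
Proof.
move=> h k hk; have [A [As [WZ ba]]] := h k hk.
apply: row_stochastic_majorization As _ WZ ba => i.
by have [/(_ i)/ltW] := equal_weightsP R hk.
Qed.

(** * Recovery of the zeros from the convex inequalities *)

(** A real-linear functional and its negative are both convex, which turns the inequality into an
    equality for the real and the imaginary part. *)
Lemma convex_sums_eq (R : realType) (I J : finType) (P : pred I) (Q : pred J)
    (X : I -> R[i]) (q : J -> R) (Y : J -> R[i]) :
  (forall Phi, convex_on_C Phi ->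
     \sum_(i | P i) Phi (X i) <= \sum_(j | Q j) q j * Phi (Y j)) ->
  \sum_(i | P i) X i = \sum_(j | Q j) (q j)%:C * Y j.
Proof.
move=> h; pose L c d (x : R[i]) : R := c * complex.Re x + d * complex.Im x.
have LD c d : {morph L c d : x y / x + y}.
  by move=> [x1 x2] [y1 y2]; rewrite /L /=; ring.
have L0 c d : L c d 0 = 0 by rewrite /L /= !mulr0 addr0.
have LZ c d t x : L c d (t%:C * x) = t * L c d x.
  by case: x => x1 x2; rewrite /L /=; ring.
have cvx c d : convex_on_C (L c d).
  by apply/convex_on_CP => t x y _; rewrite LD !LZ.
have le c d : L c d (\sum_(i | P i) X i) <= L c d (\sum_(j | Q j) (q j)%:C * Y j).
  rewrite !(big_morph _ (LD c d) (L0 c d)).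
  by under [X in _ <= X]eq_bigr do rewrite LZ; apply: h.
move: (le 1 0) (le (-1) 0) (le 0 1) (le 0 (-1)).
case: (\sum_(i | P i) X i) => x1 x2; case: (\sum_(j | Q j) _) => y1 y2.
rewrite /L /= => *; congr (_ +i* _); lra.
Qed.

Lemma zeros_of_convex_cond (R : realType) m (z : 'I_m.+1 -> R[i]) (a : 'I_m.+1 -> R)
    (w : 'I_m -> R[i]) lambda mu :
  \sum_i a i = 1 -> lambda != 0 -> convex_cond (n := m.+1) z a w lambda mu ->
  forall x : R[i],
    \sum_i (a i)%:C * \prod_(j | j != i) (x - z j) = \prod_k (x - w k).
Proof.
move=> a1 l0 cvx x.
have aC1 : \sum_i (a i)%:C = 1 by rewrite -rmorph_sum a1.
(* With this choice every factor [u + (lambda * y + mu)] equals [- lambda * (x - y)]. All products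
   have [m] factors, so the common power of [- lambda] cancels at the end. *)
pose u := - (lambda * x + mu).
have E : \sum_i (a i)%:C * \prod_(j | j != i) (u + (lambda * z j + mu)) =
    \prod_k (u + (lambda * w k + mu)).
  rewrite weighted_prod_addl_incr_tuples // prod_addl_incr_tuples.
  apply: eq_bigr => k _; congr (_ * _).
  (* The convex condition starts at [k = 1]; for [k = 0] the empty tuple is the only one, and both
     coefficients are 1. *)
  have [/val_inj k0|k0] := eqVneq (val k) (val (ord0 : 'I_m.+1)).
    have only (n : nat) (t : 0.-tuple 'I_n) : (t \in incr_tuples 0 n) = (t == [tuple]).
      by rewrite (tuple0 t) [RHS]eqxx inE.
    rewrite k0 /= (eq_bigl _ _ (only _)) big_pred1_eq.
    by rewrite (eq_bigl _ _ (only _)) big_pred1_eq !big_ord0 subr0 mulr1.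
  have hk : (1 <= k <= m)%N by rewrite lt0n k0 -ltnS ltn_ord.
  rewrite (convex_sums_eq (cvx k hk)); apply: eq_bigr => t _.
  by rewrite rmorphB rmorph1 rmorph_sum.
have F y : u + (lambda * y + mu) = - lambda * (x - y) by rewrite /u; ring.
apply: (@mulfI _ ((- lambda) ^+ m)); first by rewrite expf_neq0 ?oppr_eq0.
transitivity (\prod_k (u + (lambda * w k + mu))); last first.
  by under eq_bigr do rewrite F; rewrite big_split /= prodr_const card_ord.
rewrite -E big_distrr /=; apply: eq_bigr => i _; rewrite mulrCA; congr (_ * _).
under [in RHS]eq_bigr do rewrite F.
by rewrite [in RHS]big_split /= prodr_const cardC1 card_ord.
Qed.

(** * Stochastic matrices built from squared minors *)

(** The matrix is chosen before [lambda] and [mu], so the result yields both the stochastic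
    condition for every pair of parameters and the uniform final claim of the theorem. *)
Lemma stochastic_minors (R : realType) m (z : 'I_m.+1 -> R[i]) (a : 'I_m.+1 -> R)
    (w : 'I_m -> R[i]) :
  (0 < m)%N -> (forall i, 0 < a i) -> \sum_i a i = 1 ->
  (forall x : R[i],
    \sum_i (a i)%:C * \prod_(j | j != i) (x - z j) = \prod_k (x - w k)) ->
  forall k : nat, (1 <= k <= m)%N ->
    exists A : 'M[R]_('C(m, k), 'C(m.+1, k)),
      row_stochastic A /\
      forall lambda mu : R[i], stochastic_relation (n := m.+1) z a w A lambda mu.
Proof.
move=> m0 a0 a1 zw k /andP[_ km].
pose v : 'rV[R[i]]_m.+1 := \row_i (Num.sqrt (a i))%:C.
have va i : `|v 0 i| ^+ 2 = (a i)%:C.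
  rewrite mxE ger0_norm ?ler0c ?sqrtr_ge0 // -rmorphXn /=.
  by rewrite sqr_sqrtr ?ltW.
have v1 : v \is unitarymx.
  apply/unitarymxP/rowP => i; rewrite !ord1 !mxE.
  transitivity (\sum_i (a i)%:C); last by rewrite -rmorph_sum a1.
  by apply: eq_bigr => j _; rewrite !mxE -va mxE normCK.
have [|U [U1 Uv UD]] := @triangular_compression _ m v z w m0 v1.
  by move=> x; rewrite -zw; apply: eq_bigr => i _; rewrite va.
pose M (r : k.-tuple 'I_m) (s : k.-tuple 'I_m.+1) := \det (mxsub (tnth r) (tnth s) U).
(* The squared moduli are real elements of [R[i]]; taking the real part only moves them to [R]. *)
pose A : 'M[R]_('C(m, k), 'C(m.+1, k)) :=
  \matrix_(i, j) complex.Re (`|M (lex_tuple i) (lex_tuple j)| ^+ 2).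
have AE i j : (A i j)%:C = `|M (lex_tuple i) (lex_tuple j)| ^+ 2.
  by rewrite mxE RRe_real // realX // normr_real.
have rel lambda mu i : \prod_(j < k) (lambda * w (tnth (lex_tuple i) j) + mu) =
    \sum_j (A i j)%:C * \prod_(l < k) (lambda * z (tnth (lex_tuple j) l) + mu).
  rewrite -(UD k _ lambda mu (incr_tuples_inj (lex_tupleP i))) det_mul_diag_trmxC.
  under [RHS]eq_bigr do rewrite AE.
  rewrite (big_lex_tuple (fun t => `|M (lex_tuple i) t| ^+ 2 *
    \prod_(l < k) (lambda * z (tnth t l) + mu))).
  by apply: eq_bigr => t _; rewrite -mxsubcr.
exists A; split; first split.
- by move=> i j; rewrite -ler0c AE exprn_ge0.
(* The row sums are the case lambda = 0, mu = 1. *)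
- move=> i; apply: complexI; rewrite rmorph_sum rmorph1 /=.
  have := rel 0 1 i; rewrite big1 => [->|l _]; last by rewrite mul0r add0r.
  by apply: eq_bigr => j _; rewrite big1 ?mulr1 // => l _; rewrite mul0r add0r.
move=> lambda mu; split.
  apply/colP => i; rewrite !mxE rel.
  by apply: eq_bigr => j _; rewrite !mxE.
apply/rowP => j; rewrite !mxE.
under [RHS]eq_bigr do rewrite mxE.
rewrite -mulr_sumr; congr (_ * _); apply: complexI.
rewrite rmorphB rmorph1 !rmorph_sum /=.
under [RHS]eq_bigr do rewrite AE.
rewrite (big_lex_tuple (fun t => `|M t (lex_tuple j)| ^+ 2)).
under eq_bigr do rewrite -va.
(* The column sums are again Cauchy-Binet, now for the Gram matrix of the columns of [U] selected by
   [lex_tuple j]. *)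
rewrite -(sqr_norm_minor_complement Uv (incr_tuples_inj (lex_tupleP j))).
rewrite Cauchy_Binet; apply: eq_bigr => t _.
rewrite normCK [RHS]mulrC -det_trmxC /M; congr (_ * _); last by rewrite -mxsubrc.
by congr (\det _); apply/matrixP => l l'; rewrite !mxE.
Qed.

Theorem theorem3 (R : realType) (n : nat) (z : 'I_n -> R[i]) (a : 'I_n -> R)
    (w : 'I_n.-1 -> R[i]) :
  (2 <= n)%N ->
  injective z ->
  (forall i, 0 < a i) ->
  \sum_i a i = 1 ->
  let zeros_cond :=
    forall x : R[i],
      \sum_i (a i)%:C * \prod_(j | j != i) (x - z j) = \prod_k (x - w k) in
  [<-> zeros_cond;
       exists lambda mu : R[i], lambda != 0 /\ majorization_cond z a w lambda mu;
       exists lambda mu : R[i], lambda != 0 /\ stochastic_cond z a w lambda mu;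
       exists lambda mu : R[i], lambda != 0 /\ convex_cond z a w lambda mu;
       majorization_cond z a w 1 0;
       stochastic_cond z a w 1 0;
       convex_cond z a w 1 0]
  /\ (zeros_cond ->
      forall k : nat, (1 <= k <= n.-1)%N ->
        exists A : 'M[R]_('C(n.-1, k), 'C(n, k)),
          row_stochastic A /\
          forall lambda mu : R[i], lambda != 0 ->
            stochastic_relation z a w A lambda mu).
Proof.
case: n => [//|m] in z a w *; rewrite ltnS => m0 _ a0 a1 zeros_cond.
have stochastic : zeros_cond -> forall lambda mu, stochastic_cond z a w lambda mu.
  move=> zw lambda mu k hk.
  by have [A [As AE]] := stochastic_minors m0 a0 a1 zw hk; exists A.
have zeros lambda mu : lambda != 0 -> convex_cond z a w lambda mu -> zeros_cond.
  exact: zeros_of_convex_cond.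
have zeros' lambda mu : lambda != 0 -> majorization_cond z a w lambda mu -> zeros_cond.
  by move=> l0 /majorization_convex_cond; apply: zeros.
have one0 : 1 != 0 :> R[i] by apply: oner_neq0.
split; last first.
  move=> zw k hk; have [A [As AE]] := stochastic_minors m0 a0 a1 zw hk.
  by exists A; split=> // lambda mu _.
tfae.
- by move=> /stochastic st; exists 1, 0; split=> //; apply: stochastic_majorization_cond.
(* The hard half of Sherman's theorem is bypassed: the majorizations for all [k] together give back
   the zeros, from which the stochastic matrices are constructed. *)
- by move=> [l [mu [l0 /(zeros' _ _ l0)/stochastic st]]]; exists 1, 0.
- move=> [l [mu [l0 /stochastic_majorization_cond/majorization_convex_cond h]]].
  by exists l, mu.
- move=> [l [mu [l0 /(zeros _ _ l0)/stochastic st]]].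
  exact: stochastic_majorization_cond.
- by move=> /(zeros' _ _ one0)/stochastic.
- by move=> /stochastic_majorization_cond/majorization_convex_cond.
- exact: zeros one0.
Qed.
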